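(* For any odd prime $p$ and integers $n,d\ge 1$ with $n\ge 2d$, \[ \delta_{n,p}(d) \le \frac{1}{p^d}\left(\left(\frac{p}{p-1}\right)^d - 1\right)^{\lfloor n/(2d)\rfloor}. \] In particular, if $d\le 4$ and $n\ge 16$, then $\delta_{n,p}(d)\ll p^{-(d+2)}$ with an absolute implied constant.
   Context: $\mathbb{F}_p[x]_m$ is the set of monic polynomials in $\mathbb{F}_p[x]$. For $u\in\mathbb{F}_p[x]_m$ and $\alpha\in\mathbb{F}_p[x]/(u)$, $\mathcal{A}_n(u;\alpha) = \{(a_1,\ldots,a_n)\in(\mathbb{F}_p\setminus\{0\})^n : a_1x^{n-1}+\cdots+a_n\equiv\alpha\bmod u\}$, and $\delta_{n,p}(d) = \max_{u\in\mathbb{F}_p[x]_m,\ \deg u=d,\ x\nmid u}\ \max_{\alpha\in\mathbb{F}_p[x]/(u)}\left|\frac{|\mathcal{A}_n(u;\alpha)|}{(p-1)^n} - p^{-d}\right|$. *)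

(* Defs.v *)
From HB Require Import structures.
From mathcomp Require Import all_boot all_order all_algebra.

Set Implicit Arguments.
Unset Strict Implicit.
Unset Printing Implicit Defensive.

Import Order.TTheory GRing.Theory Num.Theory.
Local Open Scope ring_scope.

(* The 0-based entry [a i] is the paper's a_{i+1}, hence the coefficient of
   x^(n - (i + 1)). The quotient [{poly %/ u}] is F_p[x]/(u) only when u is
   monic of positive degree (otherwise mathcomp quotients by 'X). *)
Definition calA (p n : nat) (u : {poly 'F_p}) (alpha : {poly %/ u}) :
    {set {ffun 'I_n -> 'F_p}} :=
  [set a : {ffun 'I_n -> 'F_p} | [forall i, a i != 0] &
           in_qpoly u (\sum_(i < n) a i *: 'X^(n - i.+1)) == alpha].

Definition discrepancy (p n d : nat) (u : {poly 'F_p}) (alpha : {poly %/ u}) :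
    rat :=
  `| #|calA n alpha|%:R / p.-1%:R ^+ n - p%:R ^- d |.

(* All the values are rational and nonnegative, and for d >= 1 both ranges are
   nonempty (u = 'X^d + 1 qualifies), so starting the maxima at 0 is harmless.
   Every u of degree d occurs in [{poly_d.+1 'F_p}], the finite type of
   polynomials of size at most d + 1. *)
Definition delta (n p d : nat) : rat :=
  \big[Num.max/0]_(u : {poly_d.+1 'F_p} |
      [&& (u : {poly 'F_p}) \is monic, size u == d.+1 & ~~ ('X %| u)])
    \big[Num.max/0]_(alpha : {poly %/ u}) discrepancy n d alpha.

(* Main.v *)
(* Draw the digits a_i uniformly and independently. As x is a unit mod u, d
   consecutive digits induce the uniform density on (p - 1)^d distinct residues,
   whose squared L2 distance to the constant p^-d is (p - 1)^-d - p^-d. Hence,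
   by Cauchy-Schwarz, the density of a block of 2d digits, a convolution of two
   such densities, is within p^-d ((p / (p - 1))^d - 1) of p^-d in sup norm.
   Convolving with one more block multiplies that bound by
   (p / (p - 1))^d - 1, and convolving with the leftover digits does not
   increase it. *)
Require Import Defs.
From HB Require Import structures.
From mathcomp Require Import all_boot all_order all_algebra.
From mathcomp Require Import ring lra zify.

Set Implicit Arguments.
Unset Strict Implicit.
Unset Printing Implicit Defensive.

Import Order.TTheory GRing.Theory Num.Theory.
Local Open Scope ring_scope.

(** * Convolution on a finite abelian group and distance to the uniform density *)

Section Convolution.
Variables (R : realFieldType) (V : finZmodType).
Implicit Types f g : V -> R.

Definition conv f g (x : V) : R := \sum_y f y * g (x - y).

Local Notation M := (#|V|%:R : R).

Lemma sum_reflect g x : \sum_y g (x - y) = \sum_y g y.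
Proof.
rewrite [RHS](reindex (fun y => x - y)) //=.
by apply: onW_bij; exists (fun y => x - y) => y; rewrite subKr.
Qed.

Lemma card_neq0 : M != 0.
Proof. by rewrite pnatr_eq0 -lt0n; apply/card_gt0P; exists 0. Qed.

Lemma sum_const (a : R) : \sum_(y : V) a = M * a.
Proof. by rewrite sumr_const [RHS]mulr_natl. Qed.

Lemma sum_inv_card : \sum_(y : V) M^-1 = 1.
Proof. by rewrite sum_const divff // card_neq0. Qed.

(** Both functions have total mass 1, as does the constant [M^-1], so the cross terms of the
    expanded product collapse to [M^-1]. *)
Lemma conv_centered f g x : \sum_y f y = 1 -> \sum_y g y = 1 ->
  conv f g x - M^-1 = \sum_y (f y - M^-1) * (g (x - y) - M^-1).
Proof.
move=> f1 g1.
rewrite [RHS](eq_bigr (fun y => f y * g (x - y) - f y * M^-1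
  - M^-1 * (g (x - y) - M^-1))) => [|y _]; last by ring.
rewrite !sumrB -mulr_suml f1 mul1r -mulr_sumr sumrB sum_reflect g1.
by rewrite sum_inv_card subrr mulr0 subr0.
Qed.

Lemma conv_sup_mul f g (A B : R) : \sum_y f y = 1 -> \sum_y g y = 1 ->
  (forall y, `|f y - M^-1| <= A) -> (forall y, `|g y - M^-1| <= B) ->
  forall x, `|conv f g x - M^-1| <= M * (A * B).
Proof.
move=> f1 g1 fA gB x; rewrite conv_centered //.
apply: le_trans (ler_norm_sum _ _ _) _.
rewrite -sum_const; apply: ler_sum => y _.
by rewrite normrM ler_pM.
Qed.

(** The deviation of [f] is merely averaged against the probability density [g]. This absorbs the
    leftover digits. *)
Lemma conv_sup_density f g (A : R) : \sum_y f y = 1 -> \sum_y g y = 1 ->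
  (forall y, 0 <= g y) -> (forall y, `|f y - M^-1| <= A) ->
  forall x, `|conv f g x - M^-1| <= A.
Proof.
move=> f1 g1 g0 fA x.
have -> : conv f g x - M^-1 = \sum_y (f y - M^-1) * g (x - y).
  under [RHS]eq_bigr => y _ do rewrite mulrBl.
  by rewrite sumrB -mulr_sumr sum_reflect g1 mulr1.
apply: le_trans (ler_norm_sum _ _ _) _.
have -> : A = \sum_y A * g (x - y).
  by rewrite -mulr_sumr sum_reflect g1 mulr1.
apply: ler_sum => y _.
by rewrite normrM [`|g _|]ger0_norm // ler_wpM2r.
Qed.

Lemma sum_sqr_centered f : \sum_y f y = 1 ->
  \sum_y (f y - M^-1) ^+ 2 = \sum_y f y ^+ 2 - M^-1.
Proof.
move=> f1.
rewrite (eq_bigr (fun y => f y ^+ 2 - (f y *+ 2 - M^-1) * M^-1))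
  => [|y _]; last by ring.
rewrite sumrB -mulr_suml sumrB sumrMnl f1 sum_inv_card.
by ring.
Qed.

(* Cauchy-Schwarz in the symmetric case, where AM-GM is enough. *)
Lemma conv_sup_flat f g (c : R) : \sum_y f y = 1 -> \sum_y g y = 1 ->
  (forall y, f y ^+ 2 = c * f y) -> (forall y, g y ^+ 2 = c * g y) ->
  forall x, `|conv f g x - M^-1| <= c - M^-1.
Proof.
move=> f1 g1 fc gc x; rewrite conv_centered //.
(* The equation [h y ^+ 2 = c * h y] says that [h] takes only the values 0 and [c]; as its mass is
   1, its squares sum to [c]. *)
have S (h : V -> R) : \sum_y h y = 1 -> (forall y, h y ^+ 2 = c * h y) ->
    \sum_y (h y - M^-1) ^+ 2 = c - M^-1.
  move=> h1 hc; rewrite sum_sqr_centered //.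
  by under eq_bigr => y _ do rewrite hc; rewrite -mulr_sumr h1 mulr1.
apply: le_trans (ler_norm_sum _ _ _) _.
apply: (@le_trans _ _ (\sum_y ((f y - M^-1) ^+ 2 / 2
                       + (g (x - y) - M^-1) ^+ 2 / 2))); last first.
  rewrite big_split /= -!mulr_suml S //.
  rewrite (sum_reflect (fun y => (g y - M^-1) ^+ 2)) S //.
  by lra.
apply: ler_sum => y _; set a := f y - _; set b := g _ - _.
have := sqr_ge0 (`|a| - `|b|); rewrite normrM.
rewrite -(real_normK (num_real a)) -(real_normK (num_real b)).
by nra.
Qed.

End Convolution.

(** * Distribution of the sum of a window of independent digits *)

Section Windows.
Variables (R : realFieldType) (V : finZmodType) (T : finType) (D : {set T}).
Variable (w : nat -> T -> V).

(** Here [w i t] is the contribution of the digit [t] at position [i]; the offset [s] allows cutting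
    the digits into consecutive windows. *)
Definition wsum s k (a : {ffun 'I_k -> T}) : V := \sum_(i < k) w (s + i) (a i).

Definition density s k (x : V) : R :=
  (\sum_(a : {ffun 'I_k -> T} | a \in ffun_on D) (wsum s a == x)%:R)
  / #|D|%:R ^+ k.

Hypothesis D0 : (0 < #|D|)%N.

Let q0 k : (#|D|%:R : R) ^+ k != 0.
Proof. by rewrite expf_neq0 // pnatr_eq0 -lt0n. Qed.

Lemma density_ge0 s k x : 0 <= density s k x.
Proof. by rewrite divr_ge0 ?exprn_ge0 ?sumr_ge0. Qed.

Lemma density_sum s k : \sum_x density s k x = 1.
Proof.
rewrite -mulr_suml exchange_big /=.
under eq_bigr => a _.
  rewrite (bigD1 (wsum s a)) //= eqxx big1 ?addr0; last first.
    by move=> x /negPf; rewrite eq_sym => ->.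
  over.
rewrite sumr_const (_ : #|_| = #|D| ^ k)%N ?natrX ?divff //.
by rewrite -[in RHS](card_ord k) -card_ffun_on; apply: eq_card.
Qed.

Definition ffcat m k (fg : {ffun 'I_m -> T} * {ffun 'I_k -> T}) :
    {ffun 'I_(m + k) -> T} :=
  [ffun i => match split i with inl j => fg.1 j | inr j => fg.2 j end].

Lemma ffcatl m k fg (i : 'I_m) : @ffcat m k fg (lshift k i) = fg.1 i.
Proof. by rewrite ffunE (unsplitK (inl _ i)). Qed.

Lemma ffcatr m k fg (i : 'I_k) : @ffcat m k fg (rshift m i) = fg.2 i.
Proof. by rewrite ffunE (unsplitK (inr _ i)). Qed.

Lemma ffcat_bij m k : bijective (@ffcat m k).
Proof.
exists (fun a : {ffun 'I_(m + k) -> T} =>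
  ([ffun i => a (lshift k i)], [ffun i => a (rshift m i)])).
  by case=> f g; congr pair; apply/ffunP=> i; rewrite ffunE (ffcatl, ffcatr).
move=> a; apply/ffunP=> i; rewrite -(splitK i).
by case: (split i) => j /=; rewrite (ffcatl, ffcatr) ffunE.
Qed.

Lemma ffcat_on m k fg :
  (@ffcat m k fg \in ffun_on D) =
  (fg.1 \in ffun_on D) && (fg.2 \in ffun_on D).
Proof.
apply/ffun_onP/andP => [H|[/ffun_onP H1 /ffun_onP H2] i].
  by split; apply/ffun_onP=> i;
    [rewrite -(ffcatl fg) | rewrite -(ffcatr fg)].
by rewrite -(splitK i); case: (split i) => j /=; rewrite (ffcatl, ffcatr).
Qed.

Lemma wsum_ffcat s m k fg :
  wsum s (@ffcat m k fg) = wsum s fg.1 + wsum (s + m) fg.2.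
Proof.
rewrite /wsum big_split_ord /=; congr (_ + _); apply: eq_bigr => i _.
  by rewrite ffcatl.
by rewrite ffcatr addnA.
Qed.

(** Digits in adjoining windows are independent: [ffcat] identifies tuples on the long window with
    pairs of tuples on the two short ones. *)
Lemma density_conv s m k x :
  density s (m + k) x = conv (density s m) (density (s + m) k) x.
Proof.
rewrite /density (reindex (@ffcat m k)) /=; last exact/onW_bij/ffcat_bij.
under eq_bigl do rewrite ffcat_on.
rewrite -(pair_big (mem (ffun_on D)) (mem (ffun_on D))
  (fun f g => (wsum s (@ffcat m k (f, g)) == x)%:R)) /=.
rewrite /conv; under [RHS]eq_bigr => y _ do
  rewrite mulrACA -invfM -exprD.
rewrite -mulr_suml; congr (_ / _).
under [RHS]eq_bigr => y _ do rewrite mulr_suml.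
rewrite [RHS]exchange_big /=; apply: eq_bigr => f _.
(* For fixed [f], only the term [y = wsum s f] survives. *)
rewrite (bigD1 (wsum s f)) //= eqxx mul1r [X in _ + X]big1 ?addr0; last first.
  by move=> y /negPf; rewrite eq_sym => ->; rewrite mul0r.
apply: eq_bigr => g _; rewrite wsum_ffcat /=.
by rewrite [in RHS]eq_sym subr_eq addrC eq_sym.
Qed.

Variables (n d : nat).
Hypothesis w_inj : forall s, (s + d <= n)%N -> injective (@wsum s d).

(** By injectivity at most one tuple hits [x], so the count [N] is 0 or 1 and [N * N = N]. *)
Lemma density_flat s x : (s + d <= n)%N ->
  density s d x ^+ 2 = (#|D|%:R ^+ d)^-1 * density s d x.
Proof.
move=> sdn; rewrite /density; set N := \sum_(a | _) _.
suff NN : N * N = N by rewrite expr2 mulrACA NN [RHS]mulrCA.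
have [/existsP[a /andP[aD /eqP ax]]|nox] := boolP [exists a : {ffun 'I_d -> T},
    (a \in ffun_on D) && (wsum s a == x)].
  suff -> : N = 1 by rewrite mulr1.
  rewrite /N (bigD1 a) //= ax eqxx big1 ?addr0 // => b /andP[_ ba].
  by rewrite -ax (inj_eq (w_inj sdn)) (negPf ba).
suff -> : N = 0 by rewrite mulr0.
rewrite /N big1 // => a aD; apply/eqP.
rewrite pnatr_eq0 eqb0; apply: contra nox => ax.
by apply/existsP; exists a; rewrite aD.
Qed.

Local Notation M := (#|V|%:R : R).
Local Notation excess := (M / #|D|%:R ^+ d - 1).

(** One block is [conv_sup_flat], as [M^-1 * excess] is [#|D|^-d - M^-1]; in [conv_sup_mul] the
    factor [M] cancels one [M^-1]. The induction starts at one block because the empty window gives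
    a point mass. *)
Lemma density_blocks m s x : (s + m.+1 * (d + d) <= n)%N ->
  `|density s (m.+1 * (d + d)) x - M^-1| <= M^-1 * excess ^+ m.+1.
Proof.
have M0 := card_neq0 R V.
have block t y : (t + (d + d) <= n)%N ->
    `|density t (d + d) y - M^-1| <= M^-1 * excess.
  rewrite addnA => tn; rewrite density_conv mulrBr mulr1 mulKf //.
  apply: conv_sup_flat; try exact: density_sum.
    by move=> z; apply: density_flat; apply: leq_trans tn; apply: leq_addr.
  by move=> z; apply: density_flat.
elim: m s x => [|m IHm] s x; first by rewrite mul1n expr1; apply: block.
rewrite mulSn addnA => sn; rewrite density_conv exprS.
have -> : M^-1 * (excess * excess ^+ m.+1) =
  M * ((M^-1 * excess) * (M^-1 * excess ^+ m.+1)).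
  by rewrite mulrACA !mulrA divff // mul1r.
apply: conv_sup_mul; try exact: density_sum.
  by move=> y; apply: block; apply: leq_trans sn; apply: leq_addr.
by move=> y; apply: IHm.
Qed.

Lemma density_bound m x : (0 < m)%N -> (m * (2 * d) <= n)%N ->
  `|density 0 n x - M^-1| <= M^-1 * excess ^+ m.
Proof.
case: m => // m _; rewrite mul2n -addnn => mn.
rewrite -(subnKC mn) density_conv; apply: conv_sup_density.
- exact: density_sum.
- exact: density_sum.
- by move=> y; apply: density_ge0.
by move=> y; apply: density_blocks.
Qed.

End Windows.

(** * Injectivity of d consecutive digits modulo u *)

Section Polynomials.
Variables (F : finFieldType) (u : {poly F}) (n d : nat).
Hypotheses (u_monic : u \is monic) (u_size : size u = d.+1).
Hypotheses (d0 : (0 < d)%N) (Xu : ~~ ('X %| u)).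

Definition qmonom (i : nat) (t : F) : {poly %/ u} :=
  in_qpoly u (t *: 'X^(n - i.+1)).

(** The quotient is taken modulo [mk_monic u], which defaults to ['X] unless [u] is monic of
    positive degree. *)
Lemma mk_monic_id : mk_monic u = u.
Proof. by rewrite /mk_monic u_monic u_size ltnS d0. Qed.

Lemma in_qpoly_eq0 (q : {poly F}) : in_qpoly u q = 0 -> u %| q.
Proof.
move=> /(congr1 val) /= q0.
by rewrite /dvdp Pdiv.IdomainMonic.modpE // -{1}mk_monic_id q0.
Qed.

(** The difference of two window sums is a power of ['X] times some [Q] of degree below [d]. Since
    ['X] is coprime to [u], [u] divides [Q], which forces [Q = 0]. *)
Lemma qmonom_wsum_inj s : (s + d <= n)%N -> injective (@wsum _ _ qmonom s d).
Proof.
move=> sdn a b /eqP; rewrite -subr_eq0 /wsum -sumrB => /eqP ab0.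
pose Q : {poly F} := \sum_(i < d) (a i - b i) *: 'X^(d - i.+1).
have Qcoef (i : 'I_d) : Q`_(d - i.+1) = a i - b i.
  rewrite coef_sum (bigD1 i) //= coefZ coefXn eqxx mulr1 big1 ?addr0 // => j ji.
  rewrite coefZ coefXn (_ : (_ == _) = false) ?mulr0 //.
  apply/negP=> /eqP e; move/negP: ji; apply; apply/eqP/val_inj => /=.
  have := ltn_ord i; have := ltn_ord j; lia.
have uQ : u %| 'X^(n - (s + d)) * Q.
  apply: in_qpoly_eq0; rewrite -[RHS]ab0 /Q mulr_sumr raddf_sum.
  apply: eq_bigr => i _; rewrite /qmonom -linearB /= -scalerBl -scalerAr -exprD.
  by congr (in_qpoly u (_ *: 'X^_)); have := ltn_ord i; lia.
have {}uQ : u %| Q.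
  rewrite -(Gauss_dvdpr _ (_ : coprimep u 'X^(n - (s + d)))) //.
  apply: coprimep_expr; rewrite -['X]subr0 -polyC0 coprimep_XsubC.
  by rewrite -dvdp_XsubCl polyC0 subr0.
have Q0 : Q = 0.
  apply/eqP; apply: contraTT uQ => Qn0; apply/negP => /(dvdp_leq Qn0).
  rewrite u_size leqNgt ltnS; apply/negP/negPn.
  apply: leq_trans (size_sum _ _ _) _; apply/bigmax_leqP => i _.
  apply: leq_trans (size_scale_leq _ _) _; rewrite size_polyXn.
  by have := ltn_ord i; lia.
by apply/ffunP=> i; apply/eqP; rewrite -subr_eq0 -Qcoef Q0 coef0.
Qed.

Lemma card_qpoly_degree : #|{poly %/ u}| = (#|F| ^ d)%N.
Proof. by rewrite card_qpoly mk_monic_id u_size. Qed.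

End Polynomials.

(** * The discrepancy bound *)

Section Delta.
Variables (p n d : nat).
Hypotheses (p_prime : prime p) (d0 : (0 < d)%N).

Let card_digits : #|[set t : 'F_p | t != 0]| = p.-1.
Proof.
have -> : [set t : 'F_p | t != 0] = ~: [set 0] by apply/setP=> t; rewrite !inE.
by rewrite cardsC1 card_Fp.
Qed.

Lemma density_calA (u : {poly 'F_p}) (alpha : {poly %/ u}) :
  #|calA n alpha|%:R / p.-1%:R ^+ n =
  density rat [set t : 'F_p | t != 0] (@qmonom _ u n) 0 n alpha.
Proof.
rewrite /density card_digits; congr (_ / _).
rewrite -sum1_card natr_sum big_mkcond [RHS]big_mkcond /=.
apply: eq_bigr => a _; rewrite inE raddf_sum /=.
have -> : (a \in ffun_on [set t : 'F_p | t != 0]) = [forall i, a i != 0].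
  by apply/ffun_onP/forallP => H i; have := H i; rewrite inE.
by case: ifP => [/andP[-> ->]|] //; case: [forall _, _] => //= ->.
Qed.

(** The number [m] of blocks stays free: the general bound takes as many as fit, the uniform one
    takes two. *)
Lemma delta_bound m : (0 < m)%N -> (m * (2 * d) <= n)%N ->
  delta n p d <= (p%:R ^+ d)^-1 * ((p%:R / (p%:R - 1)) ^+ d - 1) ^+ m.
Proof.
move=> m0 mn; have p1 := prime_gt1 p_prime.
have pE : p.-1%:R = p%:R - 1 :> rat by rewrite -subn1 natrB // ltnW.
have p2 : 2 <= p%:R :> rat by rewrite ler_nat.
(* The maxima start at 0, so the bound itself must be nonnegative. *)
have rhs0 : 0 <= (p%:R ^+ d)^-1 * ((p%:R / (p%:R - 1)) ^+ d - 1) ^+ m :> rat.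
  rewrite mulr_ge0 ?invr_ge0 ?exprn_ge0 // subr_ge0 exprn_ege1 //.
  by rewrite ler_pdivlMr; lra.
apply/bigmax_leP; split=> // u /and3P[um /eqP us Xu].
apply/bigmax_leP; split=> // alpha _.
rewrite /discrepancy density_calA.
have D0 : (0 < #|[set t : 'F_p | t != 0%R]|)%N.
  by rewrite card_digits; move: p1; case: (p) => [|[]].
have := @density_bound rat _ _ _ _ D0 n d
  (fun s => qmonom_wsum_inj um us d0 Xu (s := s)) m alpha m0 mn.
rewrite (card_qpoly_degree um us d0) card_Fp // card_digits.
by rewrite natrX pE expr_div_n.
Qed.

End Delta.

Lemma excess_sqr_le (R : realFieldType) (P : R) d : 3 <= P -> (d <= 4)%N ->
  ((P / (P - 1)) ^+ d - 1) ^+ 2 <= 169 * (P ^+ 2)^-1.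
Proof.
move=> p3 d4; set r := P / (P - 1).
have rP : r * (P - 1) = P by rewrite divfK //; lra.
have r1 : 1 <= r by rewrite ler_pdivlMr; lra.
have r32 : r <= 3 / 2 by rewrite ler_pdivrMr; lra.
have rd1 : 1 <= r ^+ d by rewrite exprn_ege1.
have rd4 : r ^+ d <= r ^+ 4 by rewrite ler_weXn2l.
(* [65 / 8] is [1 + r + r ^+ 2 + r ^+ 3] at [r = 3 / 2]. *)
have r4 : r ^+ 4 - 1 <= 65 / 8 * (r - 1).
  have -> : r ^+ 4 - 1 = (1 + r + r ^+ 2 + r ^+ 3) * (r - 1) by ring.
  apply: ler_wpM2r; first by lra.
  have r0 : 0 <= r by lra.
  have : r ^+ 2 <= (3 / 2) ^+ 2 by rewrite lerXn2r // nnegrE; lra.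
  have : r ^+ 3 <= (3 / 2) ^+ 3 by rewrite lerXn2r // nnegrE; lra.
  by lra.
(* Since [P * (r - 1) = r <= 3 / 2], the product is at most [195 / 16], which is below 13; squaring
   13 gives 169. *)
have eP : P * (r ^+ d - 1) <= 13.
  apply: (@le_trans _ _ (P * (65 / 8 * (r - 1)))).
    by apply: ler_wpM2l; lra.
  by lra.
have e0 : 0 <= r ^+ d - 1 by lra.
rewrite ler_pdivlMr; last by rewrite exprn_gt0; lra.
rewrite mulrC -exprMn.
have -> : 169 = 13 ^+ 2 :> R by ring.
by rewrite lerXn2r // nnegrE ?mulr_ge0 //; lra.
Qed.

Theorem theorem4p1 :
  (forall p n d : nat, prime p -> odd p ->
     (1 <= n)%N -> (1 <= d)%N -> (2 * d <= n)%N ->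
     delta n p d <=
       (p%:R ^+ d)^-1 * ((p%:R / (p%:R - 1)) ^+ d - 1) ^+ (n %/ (2 * d))%N)
  /\
  (exists C : rat, forall p n d : nat, prime p -> odd p ->
     (1 <= d)%N -> (d <= 4)%N -> (16 <= n)%N ->
     delta n p d <= C * (p%:R ^+ (d + 2))^-1).
Proof.
split=> [p n d pp _ _ d1 dn|].
  apply: delta_bound => //; last exact: leq_divM.
  by rewrite divn_gt0 // muln_gt0.
(* For small p the base may exceed 1, so the bound of the first part is not
   uniform in n; two blocks of 2d digits suffice. *)
exists 169 => p n d pp podd d1 d4 n16.
(* Two blocks use [4 * d <= 16] digits, whence the threshold 16. *)
have n4d : (2 * (2 * d) <= n)%N by lia.
apply: le_trans (@delta_bound p n d pp d1 2 isT n4d) _.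
rewrite exprD invfM [leRHS]mulrCA.
apply: ler_wpM2l; first by rewrite invr_ge0 exprn_ge0.
by apply: excess_sqr_le => //; rewrite ler_nat odd_prime_gt2.
Qed.
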